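(* Let $\mathcal{E}$ be an elementary topos, let $X\in\mathcal{E}_\star$, and assume that $X$ admits an initial normal cover $\chi\colon [X]\to X$. Then $[X]$ represents the actions on $X$ in the semi-abelian category $\mathcal{E}_\star^{\mathrm{op}}$; that is, there is a bijection $\mathrm{Act}(X,G)\cong\mathcal{E}_\star([X],G)$, natural in $G\in\mathcal{E}_\star$.
   Context: $\mathcal{E}_\star$ denotes the category of pointed objects of $\mathcal{E}$: objects are pairs $(A,\star\colon \mathbf{1}\to A)$ and morphisms preserve base points. It has a zero object $\mathbf{1}$; its dual $\mathcal{E}_\star^{\mathrm{op}}$ is a semi-abelian category. Kernels and cokernels are taken in $\mathcal{E}_\star$. A normal epimorphism is a morphism of $\mathcal{E}_\star$ that is a cokernel of some morphism (equivalently, of its kernel). Initial normal cover: for $X\in\mathcal{E}_\star$, let $\mathcal{N}/X$ be the full subcategory of the slice category $\mathcal{E}_\star/X$ whose objects are the normal epimorphisms with codomain $X$. The object $X$ admits an initial normal cover when $\mathcal{N}/X$ has an initial object; this initial object is written $\chi\colon[X]\to X$ and called the initial normal cover of $X$. Actions: everything is expressed in $\mathcal{E}_\star$ rather than in its dual. For $X,G\in\mathcal{E}_\star$, $\mathrm{Act}(X,G)$ (the set of $G$-actions on $X$ in $\mathcal{E}_\star^{\mathrm{op}}$) is the set of isomorphism classes of left-split short exact sequences in $\mathcal{E}_\star$, i.e. triples $(u,v,w)$ with $u\colon G\to A$, $v\colon A\to G$, $w\colon A\to X$ such that $u$ is a kernel of $w$, $w$ is a cokernel of $u$, and $vu=\mathrm{id}_G$.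 An isomorphism $(u,v,w)\cong(u',v',w')$ is an isomorphism $\theta\colon A\to A'$ with $\theta u=u'$, $v'\theta=v$, $w'\theta=w$. For fixed $X$, $\mathrm{Act}(X,-)\colon\mathcal{E}_\star\to\mathsf{Set}$ is a covariant functor: a morphism $s\colon G\to G'$ sends the class of $(u,v,w)$ to the class of the left-split exact sequence $G'\to A+_G G'\to X$ obtained by pushing out $u$ along $s$, with retraction $(sv,\mathrm{id}_{G'})$ and cokernel map $(w,0)$. *)

(* Defs.v *)
From mathcomp Require Import all_boot.
From mathcomp Require Import boolp classical_sets.

Set Implicit Arguments.
Unset Strict Implicit.
Unset Printing Implicit Defensive.

Declare Scope cat_scope.
Delimit Scope cat_scope with cat.
Local Open Scope classical_set_scope.
Local Open Scope cat_scope.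

Record category := Category {
  ob :> Type;
  hom : ob -> ob -> Type;
  idm : forall A, hom A A;
  cmp : forall A B C, hom B C -> hom A B -> hom A C;
  cmp1m : forall A B (f : hom A B), cmp (idm B) f = f;
  cmpm1 : forall A B (f : hom A B), cmp f (idm A) = f;
  cmpA : forall A B C D (h : hom C D) (g : hom B C) (f : hom A B),
    cmp h (cmp g f) = cmp (cmp h g) f
}.
Arguments hom {c} A B.
Arguments idm {c} A.
Arguments cmp {c A B C} g f.
Notation "g ∘ f" := (cmp g f) (at level 40, left associativity) : cat_scope.

Section Universal.
Variable C : category.

Definition is_initial (I : C) := forall A : C, exists! f : hom I A, True.

Definition is_terminal (T : C) := forall A : C, exists! f : hom A T, True.

Definition is_zero_object (Z : C) := is_initial Z /\ is_terminal Z.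

Definition is_mono (A B : C) (m : hom A B) :=
  forall (T : C) (f g : hom T A), m ∘ f = m ∘ g -> f = g.

Definition is_iso (A B : C) (f : hom A B) :=
  exists g : hom B A, g ∘ f = idm A /\ f ∘ g = idm B.

(* p and q are the projections of a pullback of f and g. *)
Definition is_pullback (A B D P : C) (p : hom P A) (q : hom P B)
    (f : hom A D) (g : hom B D) :=
  f ∘ p = g ∘ q /\
  forall (T : C) (a : hom T A) (b : hom T B), f ∘ a = g ∘ b ->
    exists! h : hom T P, p ∘ h = a /\ q ∘ h = b.

(* i and j are the coprojections of a pushout of f and g. *)
Definition is_pushout (A B D P : C) (f : hom D A) (g : hom D B)
    (i : hom A P) (j : hom B P) :=
  i ∘ f = j ∘ g /\
  forall (T : C) (a : hom A T) (b : hom B T), a ∘ f = b ∘ g ->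
    exists! h : hom P T, h ∘ i = a /\ h ∘ j = b.

Definition is_equalizer (A B Q : C) (f g : hom A B) (m : hom Q A) :=
  f ∘ m = g ∘ m /\
  forall (T : C) (a : hom T A), f ∘ a = g ∘ a -> exists! h : hom T Q, m ∘ h = a.

Definition is_zero_mor (A B : C) (f : hom A B) :=
  exists (Z : C) (a : hom A Z) (b : hom Z B), is_zero_object Z /\ f = b ∘ a.

Definition is_kernel (A B K : C) (f : hom A B) (k : hom K A) :=
  is_zero_mor (f ∘ k) /\
  forall (T : C) (a : hom T A), is_zero_mor (f ∘ a) ->
    exists! h : hom T K, k ∘ h = a.

Definition is_cokernel (A B Q : C) (f : hom A B) (q : hom B Q) :=
  is_zero_mor (q ∘ f) /\
  forall (T : C) (a : hom B T), is_zero_mor (a ∘ f) ->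
    exists! h : hom Q T, h ∘ q = a.

Definition is_normal_epi (A B : C) (f : hom A B) :=
  exists (K : C) (k : hom K A), is_cokernel k f.

End Universal.

Section FullSubcategory.
Variables (C : category) (P : C -> Prop).

Definition full_subcategory : category :=
  @Category {A : C | P A} (fun A B => hom (sval A) (sval B))
    (fun A => idm (sval A)) (fun A B D g f => g ∘ f)
    (fun A B f => cmp1m f) (fun A B f => cmpm1 f)
    (fun A B D F h g f => cmpA h g f).

End FullSubcategory.

Section Slice.
Variables (C : category) (X : C).

Record slice_ob := SliceOb { slice_dom : C; slice_mor : hom slice_dom X }.

Record slice_hom (A B : slice_ob) := SliceHom {
  slice_fun : hom (slice_dom A) (slice_dom B);
  slice_funP : slice_mor B ∘ slice_fun = slice_mor A
}.

Lemma slice_hom_eq (A B : slice_ob) (f g : slice_hom A B) :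
  slice_fun f = slice_fun g -> f = g.
Proof.
case: f g => [f hf] [g hg] /= e; subst g.
by congr SliceHom; exact: Prop_irrelevance.
Qed.

Definition slice_id (A : slice_ob) : slice_hom A A := SliceHom (cmpm1 (slice_mor A)).

Lemma slice_cmp_subproof (A B D : slice_ob) (g : slice_hom B D) (f : slice_hom A B) :
  slice_mor D ∘ (slice_fun g ∘ slice_fun f) = slice_mor A.
Proof. by rewrite cmpA !slice_funP. Qed.

Definition slice_cmp (A B D : slice_ob) (g : slice_hom B D) (f : slice_hom A B) :
  slice_hom A D := SliceHom (slice_cmp_subproof g f).

Program Definition slice : category :=
  @Category slice_ob slice_hom slice_id slice_cmp _ _ _.
Next Obligation. by apply: slice_hom_eq; exact: cmp1m. Qed.
Next Obligation. by apply: slice_hom_eq; exact: cmpm1. Qed.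
Next Obligation. by apply: slice_hom_eq; exact: cmpA. Qed.

End Slice.

(* Finite limits are given as a terminal object, binary products and
   equalizers. The field [expP] says that [ev] exhibits [expo A B] as B^A,
   and [classifyP] that every monomorphism is the pullback of [tru] along
   exactly one morphism. *)
Record topos := Topos {
  topos_cat :> category;
  one : topos_cat;
  bang : forall A : topos_cat, hom A one;
  bang_uniq : forall (A : topos_cat) (f : hom A one), f = bang A;
  prd : topos_cat -> topos_cat -> topos_cat;
  prl : forall A B, hom (prd A B) A;
  prr : forall A B, hom (prd A B) B;
  pairing : forall T A B, hom T A -> hom T B -> hom T (prd A B);
  prl_pair : forall T A B (f : hom T A) (g : hom T B), prl A B ∘ pairing f g = f;
  prr_pair : forall T A B (f : hom T A) (g : hom T B), prr A B ∘ pairing f g = g;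
  pair_uniq : forall T A B (h : hom T (prd A B)),
    h = pairing (prl A B ∘ h) (prr A B ∘ h);
  eqz : forall A B : topos_cat, hom A B -> hom A B -> topos_cat;
  eqzm : forall (A B : topos_cat) (f g : hom A B), hom (eqz f g) A;
  eqzP : forall (A B : topos_cat) (f g : hom A B), is_equalizer f g (eqzm f g);
  expo : topos_cat -> topos_cat -> topos_cat;
  ev : forall A B, hom (prd (expo A B) A) B;
  expP : forall T A B (f : hom (prd T A) B),
    exists! g : hom T (expo A B), ev A B ∘ pairing (g ∘ prl T A) (prr T A) = f;
  omega : topos_cat;
  tru : hom one omega;
  classifyP : forall (A B : topos_cat) (m : hom A B), is_mono m ->
    exists! c : hom B omega, is_pullback m (bang A) c tru
}.
Arguments one {t}.

Section Pointed.
Variable E : topos.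

Record pobj := PObj { pcar : E; basept : hom one pcar }.

Record phom (A B : pobj) := PHom {
  pfun : hom (pcar A) (pcar B);
  pfunP : pfun ∘ basept A = basept B
}.

Lemma phom_eq (A B : pobj) (f g : phom A B) : pfun f = pfun g -> f = g.
Proof.
case: f g => [f hf] [g hg] /= e; subst g.
by congr PHom; exact: Prop_irrelevance.
Qed.

Definition phom_id (A : pobj) : phom A A := PHom (cmp1m (basept A)).

Lemma phom_cmp_subproof (A B D : pobj) (g : phom B D) (f : phom A B) :
  (pfun g ∘ pfun f) ∘ basept A = basept D.
Proof. by rewrite -cmpA !pfunP. Qed.

Definition phom_cmp (A B D : pobj) (g : phom B D) (f : phom A B) : phom A D :=
  PHom (phom_cmp_subproof g f).

Program Definition pointed_cat : category :=
  @Category pobj phom phom_id phom_cmp _ _ _.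
Next Obligation. by apply: phom_eq; exact: cmp1m. Qed.
Next Obligation. by apply: phom_eq; exact: cmpm1. Qed.
Next Obligation. by apply: phom_eq; exact: cmpA. Qed.

Definition pone : pointed_cat := PObj (idm one).

Lemma pone_zero : is_zero_object pone.
Proof.
split=> A.
- exists (@PHom pone A (basept A) (cmpm1 _)); split=> // f _.
  by apply: phom_eq => /=; have := pfunP f; rewrite /= cmpm1.
- have h : bang (pcar A) ∘ basept A = basept pone.
    by rewrite [LHS]bang_uniq [RHS]bang_uniq.
  exists (@PHom A pone (bang _) h); split=> // f _.
  by apply: phom_eq; rewrite [RHS]bang_uniq.
Qed.

End Pointed.

Definition normal_covers (C : category) (X : C) : category :=
  @full_subcategory (slice X) (fun p => is_normal_epi (slice_mor p)).

Definition cover_dom (C : category) (X : C) (p : normal_covers X) : C :=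
  slice_dom (sval p).

Section Actions.
Variable C : category.

Record split_seq (X G : C) := SplitSeq {
  seq_mid : C;
  seq_u : hom G seq_mid;
  seq_v : hom seq_mid G;
  seq_w : hom seq_mid X;
  seq_kernel : is_kernel seq_w seq_u;
  seq_cokernel : is_cokernel seq_u seq_w;
  seq_split : seq_v ∘ seq_u = idm G
}.

Definition seq_iso (X G : C) (e e' : split_seq X G) :=
  exists t : hom (seq_mid e) (seq_mid e'),
    [/\ is_iso t, t ∘ seq_u e = seq_u e', seq_v e' ∘ t = seq_v e
      & seq_w e' ∘ t = seq_w e].

(* e' is the pushout of e along s. That the restrictions of [seq_v e'] and
   [seq_w e'] along [seq_u e'] are the identity and zero is already part of e'
   being a left-split exact sequence, so these two morphisms are
   (s v, id) and (w, 0). *)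
Definition seq_pushout (X G G' : C) (s : hom G G') (e : split_seq X G)
    (e' : split_seq X G') :=
  exists i : hom (seq_mid e) (seq_mid e'),
    [/\ is_pushout (seq_u e) s i (seq_u e'), seq_v e' ∘ i = s ∘ seq_v e
      & seq_w e' ∘ i = seq_w e].

(* The quotient by [seq_iso], as the type of its equivalence classes. *)
Definition Act (X G : C) :=
  {c : set (split_seq X G) | exists e, c = [set e' | seq_iso e e']}.

(* The graph of Act X s : Act X G -> Act X G'. *)
Definition Act_graph (X G G' : C) (s : hom G G') (c : Act X G) (c' : Act X G') :=
  exists e e', [/\ sval c e, sval c' e' & seq_pushout s e e'].

End Actions.

(* Main.v *)
Require Import Defs.
From mathcomp Require Import all_boot.
From mathcomp Require Import boolp classical_sets.

Set Implicit Arguments.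
Unset Strict Implicit.
Unset Printing Implicit Defensive.

Local Open Scope cat_scope.

(** In terms of elements, the idea is that a left-split exact sequence
    G -> A -> X is a subobject of G x X.  Away from the base point of X the map
    w : A -> X is bijective, over the base point its fibre is G, and v is
    injective on that fibre; hence (v, w) : A -> G x X is monic and its image
    consists of the fibre G over the base point together with the graph of a
    function defined away from the base point.

    Let q : B -> X be a normal epimorphism and h : B -> A a map over X.  As q is
    surjective, the image of (v, w) must be
      D(f) = { (g, x) | x is the base point, or (g, x) = (f b, q b) for some b }
    with f = v h.  Thus the sequence is determined up to isomorphism by f
    ([seq_iso_of_lift]).  Conversely, for any f : B -> G, the subobject D(f) is a
    left-split exact sequence, and it is the pushout of a kernel k of q along f k
    ([split_seq_exists]).

    Both halves of the theorem follow.  For functoriality take B = A and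
    f = s v: the pushout of (u, v, w) along s is D(s v), and any other candidate
    receives a map from A with the same two components.  For representability
    take B = [X]: since w is a normal epimorphism, initiality gives exactly one
    h : [X] -> A over X, and the bijection sends the class of (u, v, w) to v h.
    It is injective by the first fact and surjective by the second; naturality
    holds because the map h for a pushout is the composite of the map h for the
    original sequence with the coprojection.

    To argue with elements in an elementary topos, predicates are read on
    generalized elements, and those classified by a map to the object of truth
    values are closed under equality, conjunction and universally quantified
    implication.  Disjunction and existence are then defined by quantifying over
    truth values, so that they can be eliminated into any classified predicate.
    In particular the pushout and its universal property are obtained without
    first constructing finite colimits.  The universal property of a cokernel
    enters through two facts only: q is surjective
    ([normal_epi_surjective]), and two elements with the same image under q are
    equal or both lie over the base point ([normal_epi_kernel_pair_elim]). *)

(** * Predicates on generalized elements of a topos *)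

Section InternalLogic.
Variable E : topos.
Implicit Types A B T : E.

Lemma hom_one_eq A (f g : hom A (@Defs.one E)) : f = g.
Proof. by rewrite (bang_uniq f) (bang_uniq g). Qed.

Lemma bang_cmp A T (t : hom T A) : bang A ∘ t = bang T.
Proof. exact: bang_uniq. Qed.

Lemma pairing_cmp T U A B (f : hom T A) (g : hom T B) (t : hom U T) :
  pairing f g ∘ t = pairing (f ∘ t) (g ∘ t).
Proof. by rewrite [LHS]pair_uniq !cmpA prl_pair prr_pair. Qed.

Lemma pairing_eta T A B (z : hom T (prd A B)) :
  pairing (prl A B ∘ z) (prr A B ∘ z) = z.
Proof. by rewrite -pair_uniq. Qed.

Lemma pairing_inj T A B (f f' : hom T A) (g g' : hom T B) :
  pairing f g = pairing f' g' -> f = f' /\ g = g'.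
Proof.
move=> e; split.
- by rewrite -(prl_pair f g) e prl_pair.
- by rewrite -(prr_pair f g) e prr_pair.
Qed.

Lemma equalizer_mono A B Q (f g : hom A B) (m : hom Q A) :
  is_equalizer f g m -> is_mono m.
Proof.
move=> [e univ] T a b ab.
have [h [_ hu]] : exists! h, m ∘ h = m ∘ a by apply: univ; rewrite !cmpA e.
by rewrite -(hu a erefl) -(hu b (esym ab)).
Qed.

Definition holds T (p : hom T (omega E)) : Prop := p = tru E ∘ bang T.

Lemma holds_cmp T U (p : hom T (omega E)) (t : hom U T) : holds p -> holds (p ∘ t).
Proof. by rewrite /holds => ->; rewrite -cmpA bang_cmp. Qed.

Lemma classify_mono A B (m : hom A B) : is_mono m ->
  exists c : hom B (omega E),
    forall T (x : hom T B), holds (c ∘ x) <-> exists s, m ∘ s = x.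
Proof.
move=> /classifyP [c [[cm univ] _]]; exists c => T x; split.
- by move=> /univ [s [[sx _] _]]; exists s.
- move=> [s <-]; rewrite cmpA cm; exact: (@holds_cmp _ _ _ s erefl).
Qed.

(** The map to the object of truth values is recovered from the subobject on
    which it holds, by uniqueness of the classifying map of that subobject. *)
Lemma omega_ext A (c d : hom A (omega E)) :
  (forall T (x : hom T A), holds (c ∘ x) <-> holds (d ∘ x)) -> c = d.
Proof.
move=> cd; have [cm univ] := eqzP c (tru E ∘ bang A).
have m_mono := equalizer_mono (eqzP c (tru E ∘ bang A)).
have pb (p : hom A (omega E)) :
    (forall T (x : hom T A), holds (c ∘ x) <-> holds (p ∘ x)) ->
    is_pullback (eqzm c (tru E ∘ bang A)) (bang _) p (tru E).
  move=> cp; split.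
    by apply/cp; rewrite /holds cm -cmpA bang_cmp.
  move=> T a b e.
  have ca : c ∘ a = (tru E ∘ bang A) ∘ a.
    rewrite -cmpA bang_cmp; apply/cp; rewrite /holds e; congr (_ ∘ _); exact: hom_one_eq.
  have [h [ha hu]] := univ _ _ ca.
  exists h; split=> [|h' [h'a _]]; last exact: hu.
  by split=> //; exact: hom_one_eq.
have [k [_ ku]] := classifyP m_mono.
by rewrite -(ku c (pb c (fun T x => iff_refl _))) -(ku d (pb d cd)).
Qed.

(** A predicate on the generalized elements of [A], at all stages of
    definition at once. *)
Definition pred A := forall T, hom T A -> Prop.

(** Being classified by a map to the object of truth values implies stability
    under change of stage; it is what makes a predicate define a subobject and
    admissible as the goal of an elimination. *)
Definition rep A (P : pred A) :=
  exists c : hom A (omega E), forall T (x : hom T A), P T x <-> holds (c ∘ x).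

Definition rep2 A B (P : forall T, hom T A -> hom T B -> Prop) :=
  rep (fun T (z : hom T (prd A B)) => P T (prl A B ∘ z) (prr A B ∘ z)).

(** By the Yoneda lemma such an [F] is composition with a fixed map; stating
    terms this way keeps predicates readable. *)
Definition natural A B (F : forall T, hom T A -> hom T B) :=
  forall T U (x : hom T A) (t : hom U T), F U (x ∘ t) = F T x ∘ t.

Lemma rep_ext A (P Q : pred A) :
  (forall T (x : hom T A), P T x <-> Q T x) -> rep P -> rep Q.
Proof. by move=> PQ [c cP]; exists c => T x; rewrite -cP PQ. Qed.

Lemma rep_stable A (P : pred A) T U (x : hom T A) (t : hom U T) :
  rep P -> P T x -> P U (x ∘ t).
Proof. by move=> [c cP] /cP Px; apply/cP; rewrite cmpA; exact: holds_cmp. Qed.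

Lemma rep_subst A B (P : pred B) (F : forall T, hom T A -> hom T B) :
  natural F -> rep P -> rep (fun T x => P T (F T x)).
Proof.
move=> nF [c cP]; exists (c ∘ F A (idm A)) => T x.
by rewrite cP -{1}(cmp1m x) nF cmpA.
Qed.

Lemma rep_mono A B (m : hom A B) : is_mono m ->
  rep (fun T (x : hom T B) => exists s, m ∘ s = x).
Proof.
by move=> /classify_mono [c cP]; exists c => T x; split=> /cP.
Qed.

Lemma rep_eq A B (F G : forall T, hom T A -> hom T B) :
  natural F -> natural G -> rep (fun T x => F T x = G T x).
Proof.
move=> nF nG; have EP := eqzP (F A (idm A)) (G A (idm A)).
apply: rep_ext (rep_mono (equalizer_mono EP)) => T x.
have -> : F T x = F A (idm A) ∘ x by rewrite -nF cmp1m.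
have -> : G T x = G A (idm A) ∘ x by rewrite -nG cmp1m.
split=> [[s <-]|]; first by rewrite !cmpA EP.1.
by move=> /(EP.2) [s [sx _]]; exists s.
Qed.

Lemma rep_and A (P Q : pred A) : rep P -> rep Q -> rep (fun T x => P T x /\ Q T x).
Proof.
move=> [c cP] [d dQ].
pose t T := tru E ∘ bang T.
have R : rep (fun T (x : hom T A) => pairing (c ∘ x) (d ∘ x) = pairing (t T) (t T)).
  by apply: rep_eq => T U x s /=; rewrite pairing_cmp /t -?cmpA ?bang_cmp.
apply: rep_ext R => T x; rewrite cP dQ.
by split=> [/pairing_inj|[-> ->]].
Qed.

(** The two maps to the object of truth values classifying [P] and
    [P /\ Q] have transposes from [A] to the power object of [B]; the
    quantified implication says that these transposes agree at [x]. *)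
Lemma rep_forall A B (P Q : forall T, hom T A -> hom T B -> Prop) :
  rep2 P -> rep2 Q ->
  rep (fun T x => forall U (t : hom U T) (b : hom U B), P U (x ∘ t) b -> Q U (x ∘ t) b).
Proof.
move=> rP rQ; have [d dPQ] := rep_and rP rQ; case: rP => c cP.
have [gc [gcP _]] := expP c; have [gd [gdP _]] := expP d.
have R : rep (fun T (x : hom T A) => gc ∘ x = gd ∘ x).
  by apply: rep_eq => T U x s /=; rewrite cmpA.
(* the transpose of k at x is k evaluated on all pairs with first entry x *)
have tr (k : hom (prd A B) (omega E)) g T (x : hom T A) :
    ev B (omega E) ∘ pairing (g ∘ prl A B) (prr A B) = k ->
    ev B (omega E) ∘ pairing ((g ∘ x) ∘ prl T B) (prr T B)
    = k ∘ pairing (x ∘ prl T B) (prr T B).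
  move=> <-; rewrite -(cmpA (ev B (omega E))) pairing_cmp.
  by rewrite -(cmpA g (prl A B)) prl_pair prr_pair cmpA.
apply: rep_ext R => T x; split=> [e U t b Pxb|H].
- have kk : c ∘ pairing (x ∘ t) b = d ∘ pairing (x ∘ t) b.
    have -> : pairing (x ∘ t) b
        = pairing (x ∘ prl T B) (prr T B) ∘ pairing t b.
      by rewrite pairing_cmp -cmpA prl_pair prr_pair.
    by rewrite !cmpA -(tr _ _ _ _ gcP) -(tr _ _ _ _ gdP) e.
  have /dPQ [_] : holds (d ∘ pairing (x ∘ t) b).
    by rewrite -kk; apply/cP; rewrite prl_pair prr_pair.
  by rewrite prl_pair prr_pair.
- have kk : c ∘ pairing (x ∘ prl T B) (prr T B) = d ∘ pairing (x ∘ prl T B) (prr T B).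
    apply: omega_ext => U z; rewrite -!cmpA -cP -dPQ !cmpA prl_pair prr_pair -cmpA.
    by split=> [p|[]//]; split=> //; exact: H.
  have [g [_ gu]] := expP (c ∘ pairing (x ∘ prl T B) (prr T B)).
  rewrite -(gu (gc ∘ x)); last exact: tr.
  by apply: gu; rewrite (tr _ _ _ _ gdP).
Qed.

(** The implication is the case in which the quantified variable ranges over
    the terminal object. *)
Lemma rep_imp A (P Q : pred A) : rep P -> rep Q ->
  rep (fun T x => forall U (t : hom U T), P U (x ∘ t) -> Q U (x ∘ t)).
Proof.
move=> rP rQ.
have w R : rep R -> rep2 (fun T (x : hom T A) (_ : hom T Defs.one) => R T x).
  by move=> rR; apply: (rep_subst _ rR) => T U x t; rewrite cmpA.
apply: rep_ext (rep_forall (w _ rP) (w _ rQ)) => T x.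
by split=> [H U t|H U t _]; [exact: (H U t (bang U))|exact: H].
Qed.

(** Deciding a disjunction or choosing a witness separately at each stage gives
    predicates that need not be classified.  Instead, they hold when every truth
    value [p] at a later stage that is implied by all the cases holds. *)
Definition or_pred A (P Q : pred A) : pred A := fun T x =>
  forall U (t : hom U T) (p : hom U (omega E)),
    (forall V (s : hom V U), P V (x ∘ t ∘ s) -> holds (p ∘ s)) /\
    (forall V (s : hom V U), Q V (x ∘ t ∘ s) -> holds (p ∘ s)) -> holds p.

Definition ex_pred A B (P : forall T, hom T A -> hom T B -> Prop) : pred A := fun T x =>
  forall U (t : hom U T) (p : hom U (omega E)),
    (forall V (s : hom V U) (b : hom V B), P V (x ∘ t ∘ s) b -> holds (p ∘ s)) ->
    holds p.

Lemma rep_holds2 A : rep2 (fun T (_ : hom T A) (p : hom T (omega E)) => holds p).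
Proof. by exists (prr _ _). Qed.

Lemma rep_or A (P Q : pred A) : rep P -> rep Q -> rep (or_pred P Q).
Proof.
pose bound (R : pred A) T (x : hom T A) (p : hom T (omega E)) :=
  forall V (s : hom V T), R V (x ∘ s) -> holds (p ∘ s).
have rep_bound R : rep R -> rep2 (bound R).
  move=> rR.
  have rR2 : rep (fun T (z : hom T (prd A (omega E))) => R T (prl _ _ ∘ z)).
    by apply: (rep_subst _ rR) => T U x t; rewrite cmpA.
  apply: rep_ext (rep_imp rR2 (@rep_holds2 A)) => T z.
  by split=> H V s; move: (H V s); rewrite !cmpA.
move=> rP rQ.
exact: (@rep_forall A _ (fun T x p => bound P T x p /\ bound Q T x p) _
  (rep_and (rep_bound _ rP) (rep_bound _ rQ)) (@rep_holds2 A)).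
Qed.

Lemma rep_ex A B (P : forall T, hom T A -> hom T B -> Prop) : rep2 P -> rep (ex_pred P).
Proof.
move=> rP.
pose bound T (x : hom T A) (p : hom T (omega E)) :=
  forall V (s : hom V T) (b : hom V B), P V (x ∘ s) b -> holds (p ∘ s).
suff rep_bound : rep2 bound by exact: rep_forall rep_bound (@rep_holds2 A).
pose Z := prd (prd A (omega E)) B.
have r1 : rep2 (fun T (z : hom T (prd A (omega E))) b => P T (prl _ _ ∘ z) b).
  have n : natural (fun T (z : hom T Z) =>
      pairing (prl A (omega E) ∘ (prl _ _ ∘ z)) (prr _ _ ∘ z)).
    by move=> T U x t; rewrite pairing_cmp !cmpA.
  by apply: rep_ext (rep_subst n rP) => T z; rewrite prl_pair prr_pair.
have r2 : rep2 (fun T (z : hom T (prd A (omega E))) (_ : hom T B) => holds (prr _ _ ∘ z)).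
  by apply: (rep_subst _ (@rep_holds2 A)) => T U x t; rewrite cmpA.
apply: rep_ext (rep_forall r1 r2) => T z.
by split=> H V s b; move: (H V s b); rewrite !cmpA.
Qed.

Lemma or_pred_introl A (P Q : pred A) T (x : hom T A) : rep P -> P T x -> or_pred P Q x.
Proof.
move=> rP Px U t p [HP _]; rewrite -(cmpm1 p); apply: HP.
by apply: rep_stable => //; exact: rep_stable.
Qed.

Lemma or_pred_intror A (P Q : pred A) T (x : hom T A) : rep Q -> Q T x -> or_pred P Q x.
Proof.
move=> rQ Qx U t p [_ HQ]; rewrite -(cmpm1 p); apply: HQ.
by apply: rep_stable => //; exact: rep_stable.
Qed.

Lemma ex_pred_intro A B (P : forall T, hom T A -> hom T B -> Prop) T (x : hom T A) (b : hom T B) :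
  rep2 P -> P T x b -> ex_pred P x.
Proof.
move=> rP Pxb U t p H; rewrite -(cmpm1 p); apply: (H _ _ (b ∘ t)).
have := @rep_stable _ _ _ _ (pairing x b) t rP.
by rewrite !cmpA prl_pair prr_pair cmpm1; exact.
Qed.

(** The conclusion is stated at the identity of the current stage: a goal about
    elements at stage [T] is itself a predicate of the restriction maps into
    [T], and has to be classified as such. *)
Lemma or_pred_elim A (P Q : pred A) T (x : hom T A) (R : pred T) : rep R -> or_pred P Q x ->
  (forall U (t : hom U T), P U (x ∘ t) -> R U t) ->
  (forall U (t : hom U T), Q U (x ∘ t) -> R U t) -> R T (idm T).
Proof.
move=> [c cR] PQ HP HQ; apply/cR; rewrite cmpm1; apply: (PQ T (idm T)).
by split=> V s; rewrite cmpm1; [move=> /HP|move=> /HQ]; rewrite cR.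
Qed.

Lemma ex_pred_elim A B (P : forall T, hom T A -> hom T B -> Prop) T (x : hom T A) (R : pred T) :
  rep R -> ex_pred P x ->
  (forall U (t : hom U T) b, P U (x ∘ t) b -> R U t) -> R T (idm T).
Proof.
move=> [c cR] Px H; apply/cR; rewrite cmpm1; apply: (Px T (idm T)) => V s b.
by rewrite cmpm1 => /H; rewrite cR.
Qed.

Lemma comprehension A (P : pred A) : rep P ->
  exists S (m : hom S A), is_mono m /\
    forall T (x : hom T A), P T x <-> exists s, m ∘ s = x.
Proof.
move=> [c cP]; have EP := eqzP c (tru E ∘ bang A).
exists (eqz c (tru E ∘ bang A)), (eqzm _ _); split; first exact: equalizer_mono EP.
move=> T x; rewrite cP /holds; split=> [cx|[s <-]].
- have [|s [sx _]] := EP.2 _ x; last by exists s.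
  by rewrite -cmpA bang_cmp.
- by rewrite cmpA EP.1 -!cmpA bang_cmp.
Qed.

(** Unique choice: uniqueness makes the projection from the graph of [P] to [A]
    monic, and the subobject it defines is the domain where a witness exists at
    the current stage.  So a forced unique existence yields an actual map. *)
Lemma rep_exists_unique A B (P : forall T, hom T A -> hom T B -> Prop) :
  rep2 P -> (forall T (x : hom T A) b b', P T x b -> P T x b' -> b = b') ->
  rep (fun T x => exists b, P T x b).
Proof.
move=> /comprehension [S [m [m_mono mP]]] P_uniq.
have mS T (s : hom T S) : P T (prl A B ∘ m ∘ s) (prr A B ∘ m ∘ s).
  by rewrite -!cmpA; apply/mP; exists s.
have p_mono : is_mono (prl A B ∘ m).
  move=> T s s' e; apply: m_mono.
  rewrite -(pairing_eta (m ∘ s)) -(pairing_eta (m ∘ s')) !cmpA e.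
  by congr pairing; apply: P_uniq (mS _ s) _; rewrite e; exact: mS.
apply: rep_ext (rep_mono p_mono) => T x; split=> [[s <-]|[b Pxb]].
- by exists (prr A B ∘ m ∘ s).
- have /mP [s e] : P T (prl A B ∘ pairing x b) (prr A B ∘ pairing x b).
    by rewrite prl_pair prr_pair.
  by exists s; rewrite -cmpA e prl_pair.
Qed.

End InternalLogic.

(** * Kernels and normal epimorphisms of pointed objects *)

Section PointedObjects.
Variable E : topos.
Implicit Types A B X G : pointed_cat E.
Implicit Types T U : E.

(** The base point as an element at an arbitrary stage. *)
Definition pt A T : hom T (pcar A) := basept A ∘ bang T.

Lemma pt_cmp A T U (t : hom U T) : pt A T ∘ t = pt A U.
Proof. by rewrite /pt -cmpA bang_cmp. Qed.

Lemma pt_one A : pt A Defs.one = basept A.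
Proof. by rewrite /pt (hom_one_eq (bang _) (idm _)) cmpm1. Qed.

Lemma pfun_pt A B (f : hom A B) T : pfun f ∘ pt A T = pt B T.
Proof. by rewrite /pt cmpA pfunP. Qed.

Lemma pfun_cmp A B X (g : hom B X) (f : hom A B) : pfun (g ∘ f) = pfun g ∘ pfun f.
Proof. by []. Qed.

Lemma pfun_inj A B (f g : hom A B) : pfun f = pfun g -> f = g.
Proof. exact: phom_eq. Qed.

Lemma zero_morP A B (f : hom A B) : is_zero_mor f <-> pfun f = pt B (pcar A).
Proof.
split=> [[Z [a [b [[_ Zt] ->]]]]|fE].
- have [z [_ zu]] := Zt Z.
  have c : pt Z (pcar Z) ∘ basept Z = basept Z by rewrite pt_cmp pt_one.
  have idE : idm Z = PHom c by rewrite -(zu (idm Z)) // (zu (PHom c)).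
  by rewrite -(cmp1m a) idE !pfun_cmp /= pt_cmp pfun_pt.
- have [/(_ B) [b _] /(_ A) [a _]] := pone_zero E.
  exists (pone E), a, b; split; first exact: pone_zero.
  apply: pfun_inj; rewrite fE pfun_cmp /pt -(pfunP b) -cmpA.
  by congr (_ ∘ _); exact: hom_one_eq.
Qed.

(** Kernels are tested only against pointed objects, whereas [T] carries no
    point.  The equalizer of [w] and the constant map does carry one, and its
    inclusion factors through the kernel. *)
Lemma kernel_elt A B K (w : hom A B) (u : hom K A) T (x : hom T (pcar A)) :
  is_kernel w u -> pfun w ∘ x = pt B T -> exists c, pfun u ∘ c = x.
Proof.
move=> [_ ku] wx.
have EP := eqzP (pfun w) (pt B (pcar A)).
set N := eqz _ _ in EP; set n := eqzm _ _ in EP.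
have [|s0 [ns0 _]] := EP.2 _ (basept A); first by rewrite pfunP pt_cmp pt_one.
have [|s [ns _]] := EP.2 _ x; first by rewrite wx pt_cmp.
have [|l [ul _]] := ku (PObj s0) (@PHom E (PObj s0) A n ns0).
  by apply/zero_morP => /=; rewrite EP.1 pt_cmp.
by exists (pfun l ∘ s); rewrite cmpA -pfun_cmp ul.
Qed.

Lemma kernel_zero A B K (w : hom A B) (u : hom K A) T (c : hom T (pcar K)) :
  is_kernel w u -> pfun w ∘ (pfun u ∘ c) = pt B T.
Proof. by move=> [/zero_morP z _]; rewrite cmpA -pfun_cmp z pt_cmp. Qed.

Section NormalEpi.
Variables (B X : pointed_cat E) (q : hom B X).
Hypothesis q_normal : is_normal_epi q.

(** This removes the choice of a map of which [q] is a cokernel: it suffices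
    that [a] is trivial on every element of the fibre over the base point. *)
Lemma normal_epi_factor (Y : pointed_cat E) (a : hom B Y) :
  (forall T (b : hom T (pcar B)), pfun q ∘ b = pt X T -> pfun a ∘ b = pt Y T) ->
  exists! h : hom X Y, h ∘ q = a.
Proof.
have [K [k [/zero_morP qk uni]]] := q_normal.
by move=> ha; apply: uni; apply/zero_morP; exact: ha.
Qed.

Lemma normal_epi_epi (Y : pointed_cat E) (h h' : hom X Y) : h ∘ q = h' ∘ q -> h = h'.
Proof.
move=> e; have [|g [_ gu]] := @normal_epi_factor Y (h ∘ q).
  by move=> T b qb; rewrite pfun_cmp -cmpA qb pfun_pt.
by rewrite -(gu h) // -(gu h').
Qed.

Lemma rep_preimage : rep2 (fun T (y : hom T (pcar X)) b => pfun q ∘ b = y).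
Proof. by apply: rep_eq => T U z t; rewrite !cmpA. Qed.

(** The map [q] factors through its image, which contains the base point.  By
    the universal property of [q] the inclusion of the image has a section. *)
Lemma normal_epi_surjective T (y : hom T (pcar X)) :
  ex_pred (fun T y b => pfun q ∘ b = y) y.
Proof.
have rI := rep_ex rep_preimage.
have [S [m [m_mono mP]]] := comprehension rI.
have /mP [s0 ms0] : ex_pred (fun T y b => pfun q ∘ b = y) (basept X).
  exact: (@ex_pred_intro _ _ _ _ _ _ (basept B) rep_preimage (pfunP q)).
have /mP [s ms] : ex_pred (fun T y b => pfun q ∘ b = y) (pfun q).
  exact: (@ex_pred_intro _ _ _ _ _ _ (idm _) rep_preimage (cmpm1 (pfun q))).
have s_pt : s ∘ basept B = basept (PObj s0) by apply: m_mono; rewrite cmpA ms pfunP.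
pose M : hom (PObj s0 : pointed_cat E) X := @PHom E (PObj s0) X m ms0.
have [|h [hq _]] := @normal_epi_factor (PObj s0) (@PHom E B (PObj s0) s s_pt).
  move=> U b qb; apply: m_mono; rewrite /= cmpA ms qb.
  by rewrite (pfun_pt M).
have Mh : M ∘ h = idm X.
  by apply: normal_epi_epi; rewrite -cmpA hq cmp1m; exact: pfun_inj.
apply/mP; exists (pfun h ∘ y).
by rewrite cmpA -[m ∘ pfun h]/(pfun (M ∘ h)) Mh cmp1m.
Qed.

Lemma normal_epi_surj_elim T (y : hom T (pcar X)) (R : pred T) : rep R ->
  (forall U (t : hom U T) b, pfun q ∘ b = y ∘ t -> R U t) -> R T (idm T).
Proof. by move=> rR H; exact: (ex_pred_elim rR (@normal_epi_surjective _ y) H). Qed.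

(** Collapsing the fibre over the base point identifies nothing else.  The
    relation stating that two elements are equal or both in that fibre has a
    classifying map from [B] to the power object of [B], sending an element to
    its class.  This map is constant on the fibre, hence factors through [q]. *)
Lemma normal_epi_kernel_pair_elim T (b b' : hom T (pcar B)) (R : pred T) : rep R ->
  pfun q ∘ b = pfun q ∘ b' ->
  (forall U (t : hom U T), b ∘ t = b' ∘ t -> R U t) ->
  (forall U (t : hom U T), pfun q ∘ (b ∘ t) = pt X U -> pfun q ∘ (b' ∘ t) = pt X U ->
    R U t) ->
  R T (idm T).
Proof.
pose BB := prd (pcar B) (pcar B).
pose P1 : pred BB := fun T z => prl _ _ ∘ z = prr _ _ ∘ z.
pose P2 : pred BB := fun T z =>
  pfun q ∘ (prl _ _ ∘ z) = pt X T /\ pfun q ∘ (prr _ _ ∘ z) = pt X T.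
have r1 : rep P1 by apply: rep_eq => ? ? ? ? /=; rewrite ?cmpA.
have r2 : rep P2.
  by apply: rep_and; apply: rep_eq => ? ? ? ? /=; rewrite ?pt_cmp ?cmpA.
have rP := rep_or r1 r2; have [c cP] := rP.
have [r [rE _]] := expP c.
have rc T1 (x y : hom T1 (pcar B)) :
    c ∘ pairing x y = ev _ _ ∘ pairing (r ∘ x) y.
  rewrite -rE -cmpA pairing_cmp -cmpA prl_pair prr_pair //.
(* the class of any element over the base point is the whole fibre there *)
have fibre U (x y : hom U (pcar B)) : pfun q ∘ x = pt X U ->
    (or_pred P1 P2 (pairing x y) <-> pfun q ∘ y = pt X U).
  move=> qx; split=> [xy|qy]; last first.
    by apply: or_pred_intror => //; rewrite /P2 prl_pair prr_pair.
  have rR : rep (fun V (t : hom V U) => pfun q ∘ (y ∘ t) = pt X V).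
    by apply: rep_eq => ? ? ? ? /=; rewrite ?pt_cmp ?cmpA.
  rewrite -(cmpm1 y); apply: (or_pred_elim rR xy) => V t; rewrite /P1 /P2 pairing_cmp prl_pair prr_pair.
  - by move=> <-; rewrite cmpA qx pt_cmp.
  - by case.
pose Y : pointed_cat E := PObj (r ∘ basept B).
have [|h [hq _]] := @normal_epi_factor Y (@PHom E B Y r erefl).
  move=> U x qx /=; rewrite [RHS]/pt /= -cmpA -/(pt B U).
  have [g [_ gu]] := expP (c ∘ pairing (x ∘ prl U (pcar B)) (prr _ _)).
  rewrite -(gu (r ∘ x)); last by rewrite rc cmpA.
  apply: gu; rewrite -cmpA -rc; apply: omega_ext => V z.
  rewrite -!cmpA !pairing_cmp -!cP !fibre //; first by rewrite -cmpA cmpA qx pt_cmp.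
  by rewrite bang_cmp -/(pt B _) pt_cmp pfun_pt.
move=> rR qe H1 H2.
have bb : or_pred P1 P2 (pairing b b').
  have re : r ∘ b = r ∘ b' by rewrite -[r]/(pfun (@PHom E B Y r erefl)) -hq pfun_cmp -!cmpA qe.
  apply/cP; rewrite rc re -rc; apply/cP; apply: or_pred_introl => //.
  by rewrite /P1 prl_pair prr_pair.
apply: (or_pred_elim rR bb) => U t; rewrite /P1 /P2 pairing_cmp prl_pair prr_pair.
- exact: H1.
- by case; exact: H2.
Qed.

End NormalEpi.

(** * Split exact sequences as subobjects of the product *)

Lemma seq_w_normal X G (e : split_seq X G) : is_normal_epi (seq_w e).
Proof. by exists G, (seq_u e); exact: seq_cokernel. Qed.

Lemma seq_splitE X G (e : split_seq X G) T (g : hom T (pcar G)) :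
  pfun (seq_v e) ∘ (pfun (seq_u e) ∘ g) = g.
Proof. by rewrite cmpA -pfun_cmp seq_split cmp1m. Qed.

Definition seq_emb X G (e : split_seq X G) :
    hom (pcar (seq_mid e)) (prd (pcar G) (pcar X)) :=
  pairing (pfun (seq_v e)) (pfun (seq_w e)).

Lemma seq_emb_u X G (e : split_seq X G) T (g : hom T (pcar G)) :
  seq_emb e ∘ (pfun (seq_u e) ∘ g) = pairing g (pt X T).
Proof. by rewrite pairing_cmp seq_splitE (kernel_zero _ (seq_kernel e)). Qed.

(** Two elements identified by [seq_w e] are equal or both come from [G], and
    in the latter case [seq_v e] separates them. *)
Lemma seq_emb_mono X G (e : split_seq X G) : is_mono (seq_emb e).
Proof.
move=> T a a'; rewrite !pairing_cmp => /pairing_inj [va wa].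
have rR : rep (fun U (t : hom U T) => a ∘ t = a' ∘ t).
  by apply: rep_eq => ? ? ? ? /=; rewrite ?cmpA.
rewrite -(cmpm1 a) -(cmpm1 a').
apply: (normal_epi_kernel_pair_elim (seq_w_normal e) rR wa) => // U t wat wat'.
have [c uc] := kernel_elt (seq_kernel e) wat.
have [c' uc'] := kernel_elt (seq_kernel e) wat'.
have : pfun (seq_v e) ∘ (a ∘ t) = pfun (seq_v e) ∘ (a' ∘ t) by rewrite !cmpA va.
by rewrite -uc -uc' !seq_splitE => ->.
Qed.

(** Every element of the middle object of [e] comes from [G] or from [B], and the
    images of both in the product also lie in the middle object of [e']. *)
Lemma seq_emb_sub X G B (e e' : split_seq X G) (h : hom B (seq_mid e))
    (h' : hom B (seq_mid e')) :
  is_normal_epi (seq_w e ∘ h) -> seq_w e' ∘ h' = seq_w e ∘ h ->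
  seq_v e' ∘ h' = seq_v e ∘ h ->
  exists t : hom (seq_mid e) (seq_mid e'),
    [/\ t ∘ seq_u e = seq_u e', seq_v e' ∘ t = seq_v e & seq_w e' ∘ t = seq_w e].
Proof.
move=> q_normal wh vh; have m'_mono := seq_emb_mono (e := e').
have m'h : seq_emb e' ∘ pfun h' = seq_emb e ∘ pfun h.
  by rewrite !pairing_cmp -!pfun_cmp wh vh.
have rR : rep (fun T (a : hom T (pcar (seq_mid e))) =>
    exists s, seq_emb e' ∘ s = seq_emb e ∘ a).
  have n : natural (fun T (a : hom T (pcar (seq_mid e))) => seq_emb e ∘ a).
    by move=> T U x t; rewrite cmpA.
  exact: rep_subst n (rep_mono m'_mono).
have [t mt] : exists t, seq_emb e' ∘ t = seq_emb e ∘ idm _.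
  apply: (normal_epi_surj_elim q_normal (y := pfun (seq_w e)) rR) => U a b.
  rewrite pfun_cmp -cmpA => wa; rewrite -(cmpm1 a).
  have n : natural (fun V (s : hom V U) => a ∘ s) by move=> ? ? ? ?; rewrite cmpA.
  apply: (normal_epi_kernel_pair_elim (seq_w_normal e) (rep_subst n rR) wa).
  - by move=> V s <-; exists (pfun h' ∘ (b ∘ s)); rewrite !cmpA m'h.
  - move=> V s _ /(kernel_elt (seq_kernel e)) [c <-].
    by exists (pfun (seq_u e') ∘ c); rewrite !seq_emb_u.
rewrite cmpm1 in mt.
have t_pt : t ∘ basept (seq_mid e) = basept (seq_mid e').
  by apply: m'_mono; rewrite cmpA mt !pairing_cmp !pfunP.
move: (mt); rewrite pairing_cmp => /pairing_inj [vt wt].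
exists (@PHom E _ _ t t_pt); split; apply: pfun_inj => //.
apply: m'_mono; rewrite pfun_cmp /= cmpA mt.
by rewrite -(cmpm1 (pfun (seq_u e))) -(cmpm1 (pfun (seq_u e'))) !seq_emb_u.
Qed.

Lemma seq_iso_of_lift X G B (e e' : split_seq X G) (h : hom B (seq_mid e))
    (h' : hom B (seq_mid e')) :
  is_normal_epi (seq_w e ∘ h) -> seq_w e' ∘ h' = seq_w e ∘ h ->
  seq_v e' ∘ h' = seq_v e ∘ h -> seq_iso e e'.
Proof.
move=> q_normal wh vh.
have [t [tu vt wt]] := seq_emb_sub q_normal wh vh.
have [|t' [_ vt' wt']] := seq_emb_sub (h := h') (h' := h) _ (esym wh) (esym vh).
  by rewrite wh.
exists t; split=> //; exists t'; split; apply: pfun_inj; apply: seq_emb_mono;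
  by rewrite cmpm1 !pairing_cmp -!pfun_cmp !cmpA ?vt ?vt' ?wt ?wt' ?vt ?wt.
Qed.


(** The middle object is the subobject of the product of [G] and [X] consisting
    of the fibre over the base point of [X], written [axis], and of the image of
    [(f, q)].  Elements of the two parts coincide only over the base point, so
    maps out of [B] and [G] that agree on the kernel of [q] glue. *)
Lemma split_seq_exists X G B (q : hom B X) (f : hom B G) : is_normal_epi q ->
  exists (e : split_seq X G) (i : hom B (seq_mid e)),
    [/\ seq_v e ∘ i = f, seq_w e ∘ i = q
      & forall K (k : hom K B), is_kernel q k -> is_pushout k (f ∘ k) i (seq_u e)].
Proof.
move=> q_normal; pose GX := prd (pcar G) (pcar X).
pose axis : pred GX := fun T z => prr _ _ ∘ z = pt X T.
pose img T (z : hom T GX) b := pairing (pfun f) (pfun q) ∘ b = z.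
have r1 : rep axis by apply: rep_eq => ? ? ? ? /=; rewrite ?pt_cmp ?cmpA.
have r2 : rep2 img by apply: rep_eq => ? ? ? ? /=; rewrite ?cmpA.
have r2' := rep_ex r2.
have [S [m [m_mono mP]]] := comprehension (rep_or r1 r2').
have [i0 mi] : exists s, m ∘ s = pairing (pfun f) (pfun q).
  apply/mP; apply: or_pred_intror r2' _; exact: (@ex_pred_intro _ _ _ _ _ _ (idm _) r2 (cmpm1 _)).
have [j0 mj] : exists s, m ∘ s = pairing (idm _) (pt X (pcar G)).
  by apply/mP; apply: or_pred_introl r1 _; rewrite /axis prr_pair.
have mjE T (g : hom T (pcar G)) : m ∘ (j0 ∘ g) = pairing g (pt X T).
  by rewrite cmpA mj pairing_cmp cmp1m pt_cmp.
have miE T (b : hom T (pcar B)) : m ∘ (i0 ∘ b) = pairing (pfun f ∘ b) (pfun q ∘ b).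
  by rewrite cmpA mi pairing_cmp.
(* S is covered by B and G, so that a classified goal can be checked on these *)
have cover T (s : hom T S) (R : pred T) : rep R ->
    (forall U (t : hom U T) g, j0 ∘ g = s ∘ t -> R U t) ->
    (forall U (t : hom U T) b, i0 ∘ b = s ∘ t -> R U t) -> R T (idm T).
  move=> rR HG HB; have zs : or_pred axis (ex_pred img) (m ∘ s) by apply/mP; exists s.
  apply: (or_pred_elim rR zs) => U t.
  - rewrite /axis => zt; apply: (HG _ _ (prl _ _ ∘ (m ∘ s ∘ t))); apply: m_mono.
    by rewrite mjE -zt pairing_eta cmpA.
  - have n : natural (fun V (r : hom V U) => t ∘ r) by move=> ? ? ? ?; rewrite cmpA.
    move=> zt; have := ex_pred_elim (rep_subst n rR) zt; rewrite cmpm1; apply=> V r b.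
    rewrite /img -mi -!cmpA => e; apply: HB; exact: m_mono e.
have overlap T (g : hom T (pcar G)) b : i0 ∘ b = j0 ∘ g ->
    pfun f ∘ b = g /\ pfun q ∘ b = pt X T.
  by move=> e; have := miE T b; rewrite e mjE => /esym/pairing_inj.
pose Sp : pointed_cat E := PObj (j0 ∘ basept G).
have i_pt : i0 ∘ basept B = basept Sp.
  by apply: m_mono; rewrite /= mjE miE !pfunP pt_one.
have v_pt : (prl _ _ ∘ m) ∘ basept Sp = basept G by rewrite -cmpA mjE prl_pair.
have w_pt : (prr _ _ ∘ m) ∘ basept Sp = basept X by rewrite -cmpA mjE prr_pair pt_one.
pose i := @PHom E B Sp i0 i_pt : hom B Sp.
pose u := @PHom E G Sp j0 erefl : hom G Sp.
pose v := @PHom E Sp G _ v_pt : hom Sp G.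
pose w := @PHom E Sp X _ w_pt : hom Sp X.
have vu : v ∘ u = idm G.
  by apply: pfun_inj; rewrite pfun_cmp /= -cmpA -(cmpm1 j0) mjE prl_pair.
have wu : pfun w ∘ pfun u = pt X (pcar G).
  by rewrite /= -cmpA -(cmpm1 j0) mjE prr_pair.
have vi : v ∘ i = f.
  by apply: pfun_inj; rewrite pfun_cmp /= -cmpA mi prl_pair.
have wi : w ∘ i = q.
  by apply: pfun_inj; rewrite pfun_cmp /= -cmpA mi prr_pair.
have kerw : is_kernel w u.
  split=> [|T a /zero_morP wa]; first by apply/zero_morP.
  exists (v ∘ a); split=> [|h <-]; last by rewrite cmpA vu cmp1m.
  apply: pfun_inj; apply: m_mono; rewrite !pfun_cmp /= mjE.
  by rewrite -[RHS]pairing_eta -wa pfun_cmp /= !cmpA.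
have ext Y (h h' : hom Sp Y) : h ∘ i = h' ∘ i -> h ∘ u = h' ∘ u -> h = h'.
  move=> hi hu; apply: pfun_inj; rewrite -(cmpm1 (pfun h)) -(cmpm1 (pfun h')).
  have rR : rep (fun T (s : hom T S) => pfun h ∘ s = pfun h' ∘ s).
    by apply: rep_eq => ? ? ? ? /=; rewrite cmpA.
  apply: (cover _ (idm S) _ rR) => U t x; rewrite cmp1m => <-; rewrite !cmpA.
  - by rewrite -[j0]/(pfun u) -!pfun_cmp hu.
  - by rewrite -[i0]/(pfun i) -!pfun_cmp hi.
have coku : is_cokernel u w.
  split=> [|Y a /zero_morP au]; first by apply/zero_morP.
  have [|h [hq hu]] := normal_epi_factor q_normal (a := a ∘ i).
    move=> T b qb; have -> : pfun (a ∘ i) ∘ b = pfun (a ∘ u) ∘ (pfun f ∘ b).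
      rewrite !pfun_cmp -!cmpA; congr (_ ∘ _).
      by apply: m_mono; rewrite /= mjE miE qb.
    by rewrite au pt_cmp.
  exists h; split=> [|h' h'w].
  - apply: ext; first by rewrite -cmpA wi.
    by apply: pfun_inj; rewrite au !pfun_cmp -cmpA wu pfun_pt.
  - by apply: hu; rewrite -wi cmpA h'w.
exists (SplitSeq kerw coku vu), i; split=> //= K k kerk; split.
  apply: pfun_inj; apply: m_mono.
  by rewrite !pfun_cmp /= miE mjE -(cmpm1 (pfun k)) (kernel_zero _ kerk).
move=> Y a b ab.
have abE T (x : hom T (pcar B)) : pfun q ∘ x = pt X T ->
    pfun a ∘ x = pfun b ∘ (pfun f ∘ x).
  move=> /(kernel_elt kerk) [c <-].
  by have := congr1 (fun h => pfun h ∘ c) ab; rewrite !pfun_cmp -!cmpA.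
(* [glue s y] says that y is the value at s of the map to be constructed: it is
   the common value forced by all ways of lifting s to B or to G *)
pose glue T (s : hom T S) (y : hom T (pcar Y)) :=
  (forall U (t : hom U T) x, i0 ∘ x = s ∘ t -> pfun a ∘ x = y ∘ t) /\
  (forall U (t : hom U T) x, j0 ∘ x = s ∘ t -> pfun b ∘ x = y ∘ t).
have rglue : rep2 glue.
  have r (A : pointed_cat E) (p : hom (pcar A) S) (g : hom A Y) :
      rep2 (fun T s y => forall U (t : hom U T) x, p ∘ x = s ∘ t -> pfun g ∘ x = y ∘ t).
    have rp : rep2 (fun T (z : hom T (prd S (pcar Y))) x => p ∘ x = prl _ _ ∘ z).
      by apply: rep_eq => ? ? ? ? /=; rewrite ?cmpA.
    have rg : rep2 (fun T (z : hom T (prd S (pcar Y))) x => pfun g ∘ x = prr _ _ ∘ z).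
      by apply: rep_eq => ? ? ? ? /=; rewrite ?cmpA.
    apply: rep_ext (rep_forall rp rg) => T z.
    by split=> H U t x; move: (H U t x); rewrite !cmpA.
  exact: rep_and (r _ _ _) (r _ _ _).
have glue_uniq T (s : hom T S) y y' : glue T s y -> glue T s y' -> y = y'.
  move=> [yB yG] [yB' yG'].
  have rR : rep (fun U (t : hom U T) => y ∘ t = y' ∘ t).
    by apply: rep_eq => ? ? ? ? /=; rewrite ?cmpA.
  rewrite -(cmpm1 y) -(cmpm1 y'); apply: (cover _ s _ rR) => U t x e.
  - by rewrite -(yG _ _ _ e) -(yG' _ _ _ e).
  - by rewrite -(yB _ _ _ e) -(yB' _ _ _ e).
have [h [hB hG]] : exists h, glue S (idm S) h.
  apply: (cover _ (idm S) _ (rep_exists_unique rglue glue_uniq)) => U t g; rewrite cmp1m => <-.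
  - exists (pfun b ∘ g); split=> V r x; rewrite -!cmpA.
    + by move=> /overlap [fx qx]; rewrite abE // fx.
    + by move=> e; move: (congr1 (cmp m) e); rewrite !mjE => /pairing_inj [-> _].
  - exists (pfun a ∘ g); split=> V r x; rewrite -!cmpA; last first.
      by move=> /esym/overlap [fx qx]; rewrite abE // fx.
    move=> e; move: (congr1 (cmp m) e); rewrite !miE => /pairing_inj [fe qe].
    have rR : rep (fun W (o : hom W V) => pfun a ∘ (x ∘ o) = pfun a ∘ ((g ∘ r) ∘ o)).
      by apply: rep_eq => ? ? ? ? /=; rewrite ?cmpA.
    rewrite -(cmpm1 x) -(cmpm1 (g ∘ r)).
    apply: (normal_epi_kernel_pair_elim q_normal rR qe) => W o; first by move=> ->.
    by move=> qx qg; rewrite !abE // (cmpA _ x) fe -cmpA.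
have hi : h ∘ i0 = pfun a by rewrite -(hB _ i0 (idm _)) ?cmpm1 ?cmp1m.
have hj : h ∘ j0 = pfun b by rewrite -(hG _ j0 (idm _)) ?cmpm1 ?cmp1m.
have h_pt : h ∘ basept Sp = basept Y by rewrite /= cmpA hj pfunP.
exists (@PHom E Sp Y h h_pt); split=> [|h' [h'i h'u]].
  by split; apply: pfun_inj.
by apply: ext; rewrite ?h'i ?h'u; apply: pfun_inj.
Qed.

End PointedObjects.

(** * Actions and the initial normal cover *)

Section ActionClasses.
Variables (C : category) (X : C).
Implicit Types G : C.

Lemma seq_iso_refl G (e : split_seq X G) : seq_iso e e.
Proof.
by exists (idm _); split; rewrite ?cmp1m ?cmpm1 //; exists (idm _); rewrite cmp1m.
Qed.

Lemma seq_iso_sym G (e e' : split_seq X G) : seq_iso e e' -> seq_iso e' e.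
Proof.
move=> [t [[t' [t't tt']] tu vt wt]]; exists t'; split.
- by exists t.
- by rewrite -tu cmpA t't cmp1m.
- by rewrite -vt -cmpA tt' cmpm1.
- by rewrite -wt -cmpA tt' cmpm1.
Qed.

Lemma seq_iso_trans G (e1 e2 e3 : split_seq X G) :
  seq_iso e1 e2 -> seq_iso e2 e3 -> seq_iso e1 e3.
Proof.
move=> [t [[t' [t't tt']] tu vt wt]] [s [[s' [s's ss']] su vs ws]].
exists (s ∘ t); split.
- exists (t' ∘ s'); split.
    by rewrite -cmpA (cmpA s') s's cmp1m.
  by rewrite -cmpA (cmpA t) tt' cmp1m.
- by rewrite -cmpA tu.
- by rewrite cmpA vs.
- by rewrite cmpA ws.
Qed.

Definition act_class G (e : split_seq X G) : Act X G :=
  exist _ [set e' | seq_iso e e']%classic (ex_intro _ e erefl).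

Lemma act_classP G (c : Act X G) e : sval c e -> c = act_class e.
Proof.
case: c => [S [e0 SE]] /= Se; apply: eq_exist => /=; subst S.
apply/seteqP; split=> e' /=; first exact: seq_iso_trans (seq_iso_sym Se).
exact: seq_iso_trans Se.
Qed.

Lemma act_rep G (c : Act X G) : exists e, c = act_class e.
Proof.
case: (c) => [S [e SE]]; exists e; apply: act_classP => /=.
by rewrite SE; exact: seq_iso_refl.
Qed.

Lemma act_class_eq G (e e' : split_seq X G) : seq_iso e e' -> act_class e = act_class e'.
Proof. by move=> ee'; apply/esym/act_classP/seq_iso_sym. Qed.

End ActionClasses.

Lemma Act_graph_functional (E : topos) (X G G' : pointed_cat E) (s : hom G G')
    (c : Act X G) : exists! c' : Act X G', Act_graph s c c'.
Proof.
have [e ->] := act_rep c.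
have [e' [i [vi wi po]]] := split_seq_exists (s ∘ seq_v e) (seq_w_normal e).
exists (act_class e'); split.
  exists e, e'; split; [exact: seq_iso_refl|exact: seq_iso_refl|exists i; split=> //].
  have := po _ _ (seq_kernel e).
  by rewrite -cmpA seq_split cmpm1.
move=> c' [e1 [e1' [/= [t [_ _ vt wt]] c'e1' [i1 [_ vi1 wi1]]]]].
rewrite (act_classP c'e1'); apply: act_class_eq.
apply: (seq_iso_of_lift (h := i) (h' := i1 ∘ t)).
- by rewrite wi; exact: seq_w_normal.
- by rewrite cmpA wi1 wt wi.
- by rewrite cmpA vi1 -cmpA vt vi.
Qed.

(** The projection of a split exact sequence is itself a normal cover of [X]. *)
Lemma initial_cover_lift (E : topos) (X : pointed_cat E) (chi : normal_covers X)
    (chi_initial : is_initial chi) (G : pointed_cat E) (e : split_seq X G) :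
  exists! h : hom (cover_dom chi) (seq_mid e), seq_w e ∘ h = slice_mor (sval chi).
Proof.
have [h [_ hu]] := chi_initial
  (exist _ (SliceOb (seq_w e)) (seq_w_normal e) : normal_covers X).
exists (slice_fun h); split=> [|h' wh']; first exact: (slice_funP h).
by rewrite (hu (@SliceHom _ X (sval chi) (SliceOb (seq_w e)) h' wh')).
Qed.

Theorem theorem5 (E : topos) (X : pointed_cat E) (chi : normal_covers X)
    (chi_initial : is_initial chi) :
  (forall (G G' : pointed_cat E) (s : hom G G') (c : Act X G),
     exists! c' : Act X G', Act_graph s c c') /\
  exists Phi : forall G : pointed_cat E, Act X G -> hom (cover_dom chi) G,
    (forall G : pointed_cat E, bijective (Phi G)) /\
    (forall (G G' : pointed_cat E) (s : hom G G') (c : Act X G) (c' : Act X G'),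
       Act_graph s c c' -> Phi G' c' = s ∘ Phi G c).
Proof.
split; first exact: Act_graph_functional.
pose q := slice_mor (sval chi); have q_normal : is_normal_epi q := svalP chi.
pose classifies G (c : Act X G) (f : hom (cover_dom chi) G) :=
  forall e h, sval c e -> seq_w e ∘ h = q -> seq_v e ∘ h = f.
have ex G (c : Act X G) : exists f, classifies G c f.
  have [e ->] := act_rep c; have [h [wh _]] := initial_cover_lift chi_initial e.
  exists (seq_v e ∘ h) => e' h' [t [_ _ vt wt]] wh'.
  have [h'' [_ hu]] := initial_cover_lift chi_initial e'.
  have <- : t ∘ h = h' by rewrite -(hu h') // -(hu (t ∘ h)) // cmpA wt.
  by rewrite cmpA vt.
pose Phi G (c : Act X G) := projT1 (cid (ex G c)).
have PhiP G c : classifies G c (Phi G c) := projT2 (cid (ex G c)).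
have Phi_class G (e : split_seq X G) h :
    seq_w e ∘ h = q -> Phi G (act_class e) = seq_v e ∘ h.
  by move=> wh; apply/esym/PhiP => //; exact: seq_iso_refl.
exists Phi; split=> [G|G G' s c c' [e [e' [ce c'e' [i [_ vi wi]]]]]].
- have surj f : exists c, Phi G c = f.
    have [e [i [vi wi _]]] := split_seq_exists f q_normal.
    by exists (act_class e); rewrite (Phi_class _ _ _ wi).
  exists (fun f => projT1 (cid (surj f))) => [c|f]; last exact: projT2 (cid (surj f)).
  case: cid => c' /=; have [e ->] := act_rep c; have [e' ->] := act_rep c'.
  have [h [wh _]] := initial_cover_lift chi_initial e.
  have [h' [wh' _]] := initial_cover_lift chi_initial e'.
  rewrite (Phi_class _ _ _ wh) (Phi_class _ _ _ wh') => vv; apply: act_class_eq.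
  by apply: (seq_iso_of_lift (h := h') (h' := h)); rewrite ?wh' ?wh.
- have [h [wh _]] := initial_cover_lift chi_initial e.
  rewrite (act_classP ce) (act_classP c'e') (Phi_class _ _ _ wh).
  by rewrite (Phi_class _ _ (i ∘ h)) ?cmpA ?vi ?wi.
Qed.
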